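(* Let $V$ be a vector superspace over a field $\mathbb F$ of characteristic $0$ (parity $p$) with an even endomorphism $\partial$, and let $\Pi V$ be $V$ with reversed parity $\bar p=1-p$. The space $W^{\mathrm{ch}}_1(\Pi V)$ is identified, via $$\int^{\lambda}d\sigma[u_\sigma v]=(-1)^{p(u)}X^{z_1,z_2}_{\lambda,-\lambda-\partial}\Big(u,v;\frac1{z_2-z_1}\Big),\qquad X\in W_1^{\mathrm{ch}}(\Pi V),$$ with the space of integral $\lambda$-brackets $\int^\lambda d\sigma[\cdot\,_\sigma\,\cdot]:V\otimes V\to V[\lambda]$ satisfying the sesquilinearity axiom (ii) and the skewsymmetry axiom (iii) of the context.
   Context: $\langle\Phi\rangle$ denotes the image of an endomorphism $\Phi$. $W_1^{\mathrm{ch}}(\Pi V)$ is the superspace of linear maps $X:\Pi V\otimes\Pi V\otimes\mathbb F[z_{12}^{\pm1}]\to\Pi V[\lambda_1,\lambda_2]/\langle\partial+\lambda_1+\lambda_2\rangle$ ($z_{ij}=z_i-z_j$), written $X^{z_1,z_2}_{\lambda_1,\lambda_2}(v_1,v_2;f)$, such that: $X((\partial+\lambda_1)v_1,v_2;f)=X(v_1,v_2;\partial f/\partial z_1)$, $X(v_1,(\partial+\lambda_2)v_2;f)=X(v_1,v_2;\partial f/\partial z_2)$, $X(v_1,v_2;z_{ij}f)=(\partial_{\lambda_j}-\partial_{\lambda_i})X(v_1,v_2;f)$, and which are symmetric: $X^{z_1,z_2}_{\lambda_1,\lambda_2}(v_1,v_2;f(z_1,z_2))=(-1)^{\bar p(v_1)\bar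 p(v_2)}X^{z_1,z_2}_{\lambda_2,\lambda_1}(v_2,v_1;f(z_2,z_1))$. The isomorphism $V[\lambda_1,\lambda_2]/\langle\partial+\lambda_1+\lambda_2\rangle\simeq V[\lambda]$ is given by $\lambda_1=\lambda$, $\lambda_2=-\lambda-\partial$ (with $\partial$ acting on coefficients), and $\Pi V$ and $V$ are identified as vector spaces. An integral $\lambda$-bracket is a linear map $V\otimes V\to V[\lambda]$, $u\otimes v\mapsto\int^\lambda d\sigma[u_\sigma v]$; its constant term is denoted $:\!uv\!:$ and its derivative in $\lambda$ is $[u_\lambda v]$. (ii) $\int^\lambda d\sigma[\partial u_\sigma v]=-\int^\lambda d\sigma\,\sigma[u_\sigma v]$, $\int^\lambda d\sigma[u_\sigma\partial v]=\int^\lambda d\sigma(\partial+\sigma)[u_\sigma v]$; explicitly: $[\partial u_\lambda v]=-\lambda[u_\lambda v]$, $[u_\lambda\partial v]=(\partial+\lambda)[u_\lambda v]$, and $\partial:\!uv\!:\,=\,:\!(\partial u)v\!:+:\!u\,\partial v\!:$. (iii) $\int^\lambda d\sigma[v_\sigma u]=(-1)^{p(u)p(v)}\int^{-\lambda-\partial}d\sigma[u_\sigma v]$ (substitute $-\lambda-\partial$ for $\lambda$, $\partial$ acting on coefficients from the left). *)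

(* Defs.v *)
From HB Require Import structures.
From mathcomp Require Import all_boot all_order all_algebra.
From mathcomp Require Import generic_quotient ring_quotient.
From mathcomp Require Import finmap.
From mathcomp Require Import boolp classical_sets functions cardinality fsbigop.

Set Implicit Arguments.
Unset Strict Implicit.
Unset Printing Implicit Defensive.

Import GRing.Theory.
Local Open Scope fset_scope.
Local Open Scope classical_set_scope.
Local Open Scope ring_scope.

(* A vector superspace [V = V_0 (+) V_1]: the decomposition is given by its two
   projections, [sproj S b] being the projection onto the part of parity [b]
   ([false] = even, [true] = odd). *)
Record superspace (F : fieldType) (V : lmodType F) := Superspace {
  sproj : bool -> {linear V -> V};
  sproj_sum : forall v, sproj false v + sproj true v = v;
  sproj_proj : forall a b v,
    sproj a (sproj b v) = if a == b then sproj b v else 0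
}.

Definition has_parity (F : fieldType) (V : lmodType F) (S : superspace V)
  (b : bool) (v : V) : Prop := sproj S b v = v.

Definition even_endo (F : fieldType) (V : lmodType F) (S : superspace V)
  (d : {linear V -> V}) : Prop :=
  forall b v, has_parity S b v -> has_parity S b (d v).

Section Reversed.
Variables (F : fieldType) (V : lmodType F) (S : superspace V).

Fact revpar_sum v : sproj S (~~ false) v + sproj S (~~ true) v = v.
Proof. by rewrite addrC sproj_sum. Qed.

Fact revpar_proj a b v :
  sproj S (~~ a) (sproj S (~~ b) v) = if a == b then sproj S (~~ b) v else 0.
Proof. by rewrite sproj_proj; case: a b => [] []. Qed.

(* [Pi V]: same underlying vector space, parity [1 - p]. *)
Definition revpar : superspace V :=
  Superspace (sproj := fun b => sproj S (~~ b)) revpar_sum revpar_proj.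

End Reversed.

(* [{fs I, V}]: finitely supported functions [I -> V], i.e. formal finite sums
   of [x^i v] with [i : I] an exponent and [v : V] its coefficient.  With
   [I = nat], [nat * nat], [int] these are [V[lambda]], [V[lambda_1, lambda_2]]
   and [V[z^{+1}, z^{-1}]]. *)
Section FinSupp.
Variables (F : fieldType) (I : choiceType) (V : lmodType F).

Definition fs_pred : {pred I -> V} :=
  fun f => `[< finite_set [set i | f i != 0] >].

Fact fs_pred_closed : submod_closed fs_pred.
Proof.
split; first by apply/asboolP; apply: sub_finite_set (finite_set0 I) => i /=;
  rewrite eqxx.
move=> a f g /asboolP ff /asboolP fg; apply/asboolP.
apply: (@sub_finite_set _ _ ([set i | f i != 0] `|` [set i | g i != 0])).
  move=> i /=; case: (eqVneq (f i) 0) => [f0|]; last by left.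
  case: (eqVneq (g i) 0) => [g0|]; last by right.
  by rewrite !fctE f0 g0 scaler0 addr0 eqxx.
by rewrite finite_setU.
Qed.

HB.instance Definition _ :=
  GRing.isSubmodClosed.Build F (I -> V) fs_pred fs_pred_closed.

Record fs := Fs { fs_fun :> I -> V; _ : fs_fun \in fs_pred }.

HB.instance Definition _ := [isSub for fs_fun].
HB.instance Definition _ := [Choice of fs by <:].
HB.instance Definition _ := [SubChoice_isSubLmodule of fs by <:].

Lemma fsP (f g : fs) : f =1 g -> f = g.
Proof. by move=> fg; apply/val_inj/funext. Qed.

Lemma fs_finite (f : fs) : finite_set [set i | f i != 0].
Proof. by apply/asboolP; exact: (valP f). Qed.

Lemma fsD_E (f g : fs) i : (f + g) i = f i + g i. Proof. by []. Qed.
Lemma fsZ_E a (f : fs) i : (a *: f) i = a *: f i. Proof. by []. Qed.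
Lemma fs0_E i : (0 : fs) i = 0. Proof. by []. Qed.

Fact mono_subproof i (v : V) : (fun j => if j == i then v else 0) \in fs_pred.
Proof.
apply/asboolP/(sub_finite_set _ (finite_set1 i)) => j /=.
by case: (eqVneq j i) => // _; rewrite eqxx.
Qed.

End FinSupp.

Notation "{ 'fs' I , V }" := (@fs _ I V) (at level 0, format "{ 'fs'  I ,  V }").

(* The monomial [x^i v]. *)
HB.lock Definition mono (F : fieldType) (I : choiceType) (V : lmodType F)
  (i : I) (v : V) : {fs I, V} := Fs (mono_subproof i v).
Arguments mono {F I V} i v.

Section Mono.
Variables (F : fieldType) (I : choiceType) (V : lmodType F).

Lemma monoE (i : I) (v : V) j : mono i v j = if j == i then v else 0.
Proof. by rewrite mono.unlock. Qed.

Fact mono_is_linear i : linear (@mono F I V i).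
Proof.
move=> a u v; apply: fsP => j; rewrite fsD_E fsZ_E !monoE.
by case: eqP => //; rewrite scaler0 addr0.
Qed.

HB.instance Definition _ i :=
  GRing.isLinear.Build F V {fs I, V} *:%R (mono i) (mono_is_linear i).

End Mono.

(* The linear map sending [x^i v] to [h i v]. *)
HB.lock Definition fslin (F : fieldType) (I : choiceType) (V W : lmodType F)
  (h : I -> {linear V -> W}) (f : {fs I, V}) : W :=
  \sum_(i \in [set: I]) h i (f i).
Arguments fslin {F I V W} h f.

Section FsLin.
Variables (F : fieldType) (I : choiceType) (V W : lmodType F).
Implicit Type h : I -> {linear V -> W}.

Lemma fslin_seq h (f : {fs I, V}) (A : {fset I}) :
  [set i | f i != 0] `<=` [set` A] -> fslin h f = \sum_(i <- A) h i (f i).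
Proof.
move=> fA; rewrite fslin.unlock (fsbigTE A) // => i iA.
case: (eqVneq (f i) 0) => [->|fi]; first by rewrite linear0.
by move: iA; rewrite (fA i fi).
Qed.

Fact fslin_is_linear h : linear (fslin h).
Proof.
move=> a f g.
have fUg : finite_set ([set i | f i != 0] `|` [set i | g i != 0]).
  by rewrite finite_setU; split; exact: fs_finite.
have [A EA] := finite_fsetP.1 fUg.
have Af : [set i | f i != 0] `<=` [set` A] by rewrite -EA => i; left.
have Ag : [set i | g i != 0] `<=` [set` A] by rewrite -EA => i; right.
have Afg : [set i | (a *: f + g) i != 0] `<=` [set` A].
  rewrite -EA => i; change (a *: f i + g i != 0 -> f i != 0 \/ g i != 0).
  case: (eqVneq (f i) 0) => [->|]; last by left.
  by rewrite scaler0 add0r; right.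
rewrite !(fslin_seq _ Af, fslin_seq _ Ag, fslin_seq _ Afg).
rewrite scaler_sumr -big_split /=; apply: eq_bigr => i _.
by rewrite -linearP.
Qed.

HB.instance Definition _ h :=
  GRing.isLinear.Build F {fs I, V} W *:%R (fslin h) (fslin_is_linear h).

Lemma fslin_mono h i v : fslin h (mono i v) = h i v.
Proof.
rewrite (@fslin_seq _ _ [fset i]) ?big_seq_fset1 ?monoE ?eqxx //.
by move=> j; rewrite /= monoE in_fset1; case: (j == i); rewrite ?eqxx.
Qed.

End FsLin.

Lemma fs_sum_mono (F : fieldType) (I : choiceType) (V : lmodType F)
  (f : {fs I, V}) : exists A : seq I, f = \sum_(i <- A) mono i (f i).
Proof.
have [A EA] := finite_fsetP.1 (fs_finite f).
exists A; apply: fsP => j.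
have -> : (\sum_(i <- A) mono i (f i)) j = \sum_(i <- A) mono i (f i) j.
  by elim/big_rec2: _ => // i y1 y2 _ <-; rewrite fsD_E.
have [jA|jA] := boolP (j \in A).
  rewrite (big_fsetD1 j) //= monoE eqxx big_seq big1 ?addr0 // => i.
  by rewrite in_fsetD1 monoE eq_sym => /andP[/negPf ->].
have f0 : f j = 0.
  apply/eqP/contraT => fj; have : [set i | f i != 0] j by [].
  by rewrite EA /= (negPf jA).
rewrite f0 big_seq big1 // => i iA; rewrite monoE.
by case: eqP => // e; rewrite e iA in jA.
Qed.

Lemma fs_lin_ext (F : fieldType) (I : choiceType) (V W : lmodType F)
  (a b : {linear {fs I, V} -> W}) :
  (forall i v, a (mono i v) = b (mono i v)) -> a =1 b.
Proof.
move=> ab f; have [A ->] := fs_sum_mono f.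
by rewrite !linear_sum; apply: eq_bigr => i _; exact: ab.
Qed.

(* The linear map [x^i v |-> x^(g i) (c i *: v)]. *)
Definition mmap (F : fieldType) (I J : choiceType) (V : lmodType F)
  (c : I -> F) (g : I -> J) : {linear {fs I, V} -> {fs J, V}} :=
  fslin (fun i => c i \*: mono (g i)).

Lemma mmap_mono (F : fieldType) (I J : choiceType) (V : lmodType F)
  (c : I -> F) (g : I -> J) i (v : V) :
  mmap V c g (mono i v) = mono (g i) (c i *: v).
Proof. by rewrite /mmap /= fslin_mono /= -linearZ. Qed.

(* [d] acting on coefficients. *)
Definition coefd (F : fieldType) (I : choiceType) (V : lmodType F)
  (d : {linear V -> V}) : {linear {fs I, V} -> {fs I, V}} :=
  fslin (fun i => mono i \o d).

Lemma coefd_mono (F : fieldType) (I : choiceType) (V : lmodType F)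
  (d : {linear V -> V}) i (v : V) : coefd I d (mono i v) = mono i (d v).
Proof. by rewrite /coefd /= fslin_mono. Qed.

Section IterLinear.
Variables (F : fieldType) (U : lmodType F) (f : {linear U -> U}) (n : nat).

Definition iter_lin (u : U) : U := iter n f u.

Fact iter_lin_is_linear : linear iter_lin.
Proof.
by rewrite /iter_lin => a u v; elim: n => //= m ->; rewrite linearP.
Qed.

HB.instance Definition _ :=
  GRing.isLinear.Build F U U *:%R iter_lin iter_lin_is_linear.

End IterLinear.

(* [V[lambda]]. *)
Notation vpoly V := {fs nat, V}.
(* [V[lambda_1, lambda_2]]; the exponent [(i, j)] is
   [lambda_1 ^ i * lambda_2 ^ j]. *)
Notation vpoly2 V := {fs (nat * nat)%type, V}.

Section Poly.
Variables (F : fieldType) (V : lmodType F) (d : {linear V -> V}).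

Definition lmul : {linear vpoly V -> vpoly V} := mmap V (fun=> 1) succn.

Definition lderiv : {linear vpoly V -> vpoly V} := mmap V (fun n => n%:R) predn.

Definition lconst (f : vpoly V) : V := f 0%N.

(* Multiplication by [- lambda - d]. *)
Definition mlamd (f : vpoly V) : vpoly V := - lmul f - coefd _ d f.

Fact mlamd_is_linear : linear mlamd.
Proof.
move=> a f g; rewrite /mlamd (linearP lmul) (linearP (coefd _ d)).
by rewrite !opprD addrACA scalerDr !scalerN.
Qed.

HB.instance Definition _ :=
  GRing.isLinear.Build F (vpoly V) (vpoly V) *:%R mlamd mlamd_is_linear.

(* Substitution of [- lambda - d] for [lambda]. *)
Definition lsubst : {linear vpoly V -> vpoly V} :=
  fslin (fun n => iter_lin mlamd n \o mono 0%N).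

Definition lmul1 : {linear vpoly2 V -> vpoly2 V} :=
  mmap V (fun=> 1) (fun p => (p.1.+1, p.2)).
Definition lmul2 : {linear vpoly2 V -> vpoly2 V} :=
  mmap V (fun=> 1) (fun p => (p.1, p.2.+1)).
Definition lderiv1 : {linear vpoly2 V -> vpoly2 V} :=
  mmap V (fun p => p.1%:R) (fun p => (p.1.-1, p.2)).
Definition lderiv2 : {linear vpoly2 V -> vpoly2 V} :=
  mmap V (fun p => p.2%:R) (fun p => (p.1, p.2.-1)).
Definition lswap : {linear vpoly2 V -> vpoly2 V} :=
  mmap V (fun=> 1) (fun p => (p.2, p.1)).

Definition lderiv21 : {linear vpoly2 V -> vpoly2 V} := lderiv2 \- lderiv1.
Definition lderiv12 : {linear vpoly2 V -> vpoly2 V} := lderiv1 \- lderiv2.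

Definition dlam12 : {linear vpoly2 V -> vpoly2 V} :=
  coefd _ d \+ (lmul1 \+ lmul2).

(* The image of [d + lambda_1 + lambda_2]. *)
Definition dlam_img : {pred vpoly2 V} := fun f => `[< exists g, f = dlam12 g >].

Fact dlam_img_closed : submod_closed dlam_img.
Proof.
split; first by apply/asboolP; exists 0; rewrite linear0.
move=> a f g /asboolP[f' ->] /asboolP[g' ->]; apply/asboolP.
by exists (a *: f' + g'); rewrite linearP.
Qed.

HB.instance Definition _ :=
  GRing.isSubmodClosed.Build F (vpoly2 V) dlam_img dlam_img_closed.

(* [V[lambda_1, lambda_2] / <d + lambda_1 + lambda_2>]. *)
Definition qpoly := Quotient.quot dlam_img.
HB.instance Definition _ := Choice.on qpoly.
HB.instance Definition _ := GRing.Zmodule.on qpoly.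

Definition qpi (f : vpoly2 V) : qpoly := (\pi_(Quotient.quot dlam_img) f)%qT.
Definition qrep (q : qpoly) : vpoly2 V := repr (q : Quotient.quot dlam_img).

Lemma qrepK q : qpi (qrep q) = q. Proof. exact: reprK. Qed.

Lemma qpiP f g : qpi f = qpi g <-> exists h, f - g = dlam12 h.
Proof.
split=> [/eqP e|[h e]].
  by apply/asboolP; move: e; rewrite /qpi -Quotient.idealrBE.
by apply/eqP; rewrite /qpi -Quotient.idealrBE; apply/asboolP; exists h.
Qed.

Lemma qpiD f g : qpi (f + g) = qpi f + qpi g.
Proof. by rewrite /qpi raddfD. Qed.

(* Operator induced on the quotient by [op]; it is the genuine induced map as
   soon as [op] preserves the image of [d + lambda_1 + lambda_2] ([qlift_pi]),
   which all operators used below do since they commute with it. *)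
Definition qlift (op : vpoly2 V -> vpoly2 V) (q : qpoly) : qpoly :=
  qpi (op (qrep q)).

Lemma qlift_pi (op : {linear vpoly2 V -> vpoly2 V}) :
  (forall f, op (dlam12 f) = dlam12 (op f)) ->
  forall f, qlift op (qpi f) = qpi (op f).
Proof.
move=> comm f; apply/qpiP.
have /qpiP[h e] := qrepK (qpi f).
by exists (op h); rewrite -linearB e comm.
Qed.

Definition qscale (a : F) : qpoly -> qpoly := qlift (a \*: idfun).

Lemma qscale_pi a f : qscale a (qpi f) = qpi (a *: f).
Proof.
apply: (@qlift_pi (a \*: idfun)) => g.
exact: (esym (linearZ_LR dlam12 a g)).
Qed.

Fact qscaleA a b q : qscale a (qscale b q) = qscale (a * b) q.
Proof. by rewrite -[q]qrepK !qscale_pi scalerA. Qed.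
Fact qscale1 : left_id 1 qscale.
Proof. by move=> q; rewrite -[q]qrepK qscale_pi scale1r. Qed.
Fact qscaleDr : right_distributive qscale +%R.
Proof.
move=> a q r; rewrite -[q]qrepK -[r]qrepK -qpiD !qscale_pi -qpiD.
by rewrite scalerDr.
Qed.
Fact qscaleDl q : {morph qscale^~ q : a b / a + b}.
Proof. by move=> a b; rewrite -[q]qrepK !qscale_pi -qpiD scalerDl. Qed.

HB.instance Definition _ := GRing.Zmodule_isLmodule.Build F qpoly
  qscaleA qscale1 qscaleDr qscaleDl.

Lemma qpiZ a f : qpi (a *: f) = a *: qpi f.
Proof. by rewrite -qscale_pi. Qed.

Fact qpi_is_linear : linear qpi.
Proof. by move=> a f g; rewrite qpiD qpiZ. Qed.
HB.instance Definition _ :=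
  GRing.isLinear.Build F (vpoly2 V) qpoly *:%R qpi qpi_is_linear.

Lemma qlift_linear (op : {linear vpoly2 V -> vpoly2 V}) :
  (forall f, op (dlam12 f) = dlam12 (op f)) -> linear (qlift op).
Proof.
move=> comm a q r; rewrite -[q]qrepK -[r]qrepK -linearP !qlift_pi //.
by rewrite !linearP.
Qed.

Lemma dlam12_mono p (v : V) : dlam12 (mono p v) =
  mono p (d v) + (mono (p.1.+1, p.2) v + mono (p.1, p.2.+1) v).
Proof. by rewrite /= coefd_mono !mmap_mono !scale1r. Qed.

Lemma comm_on_mono (op : {linear vpoly2 V -> vpoly2 V}) :
  (forall p v, op (dlam12 (mono p v)) = dlam12 (op (mono p v))) ->
  forall f, op (dlam12 f) = dlam12 (op f).
Proof.
move=> H f; have [A ->] := fs_sum_mono f.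
by rewrite !linear_sum; apply: eq_bigr => i _; exact: H.
Qed.

Fact lmul1_comm f : lmul1 (dlam12 f) = dlam12 (lmul1 f).
Proof.
move: f; apply: (comm_on_mono (op := lmul1)).
move=> p v; rewrite dlam12_mono !linearD !mmap_mono !scale1r.
by rewrite dlam12_mono.
Qed.

Fact lmul2_comm f : lmul2 (dlam12 f) = dlam12 (lmul2 f).
Proof.
move: f; apply: (comm_on_mono (op := lmul2)).
move=> p v; rewrite dlam12_mono !linearD !mmap_mono !scale1r.
by rewrite dlam12_mono.
Qed.

Fact lswap_comm f : lswap (dlam12 f) = dlam12 (lswap f).
Proof.
move: f; apply: (comm_on_mono (op := lswap)).
move=> p v; rewrite dlam12_mono !linearD !mmap_mono !scale1r.
by rewrite dlam12_mono /=; congr (_ + _); rewrite addrC.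
Qed.

Fact lderiv21_comm f : lderiv21 (dlam12 f) = dlam12 (lderiv21 f).
Proof.
move: f; apply: (comm_on_mono (op := lderiv21)) => -[i j] v.
have E (k l : nat) w : lderiv21 (mono (k, l) w) =
    mono (k, l.-1) (l%:R *: w) - mono (k.-1, l) (k%:R *: w).
  rewrite -[LHS]/(lderiv2 (mono (k, l) w) - lderiv1 (mono (k, l) w)).
  by congr (_ - _); exact: mmap_mono.
rewrite E linearB !dlam12_mono (linearD lderiv21) (linearD lderiv21) !E /=.
have e1 : mono (i.-1.+1, j) (i%:R *: v) = mono (i, j) (i%:R *: v).
  by case: i => //; rewrite scale0r !linear0.
have e2 : mono (i, j.-1.+1) (j%:R *: v) = mono (i, j) (j%:R *: v).
  by case: j {e1} => //; rewrite scale0r !linear0.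
rewrite e1 e2 -[i.+1]addn1 -[j.+1]addn1 !natrD !scalerDl !scale1r.
rewrite (linearD (mono (i, j)) (i%:R *: v)) (linearD (mono (i, j)) (j%:R *: v)).
rewrite !(linearZ_LR d) /=.
set m := mono (i, j) v; set x := mono _ (i%:R *: v).
set y := mono (i, j) (j%:R *: v).
set a := mono _ (j%:R *: d v); set b := mono _ (i%:R *: d v).
set c := mono _ _; set e := mono _ _.
rewrite (addrACA c) -[- (x + m) - e]opprD addrACA -opprD.
rewrite [y + m]addrC [x + m]addrC -[m + x + e]addrA (addrCA c) (addrCA a).
by rewrite (addrCA b) opprD addrACA subrr add0r.
Qed.

Fact lderiv12_comm f : lderiv12 (dlam12 f) = dlam12 (lderiv12 f).
Proof.
have E g : lderiv12 g = - lderiv21 g.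
  by rewrite -[RHS]/(- (lderiv2 g - lderiv1 g)) opprB.
by rewrite !E lderiv21_comm linearN.
Qed.

Definition qlmul1 := qlift lmul1.
Definition qlmul2 := qlift lmul2.
Definition qlderiv21 := qlift lderiv21.
Definition qlderiv12 := qlift lderiv12.
Definition qlswap := qlift lswap.

HB.instance Definition _ := GRing.isLinear.Build F qpoly qpoly *:%R
  qlmul1 (qlift_linear lmul1_comm).
HB.instance Definition _ := GRing.isLinear.Build F qpoly qpoly *:%R
  qlmul2 (qlift_linear lmul2_comm).
HB.instance Definition _ := GRing.isLinear.Build F qpoly qpoly *:%R
  qlderiv21 (qlift_linear lderiv21_comm).
HB.instance Definition _ := GRing.isLinear.Build F qpoly qpoly *:%R
  qlderiv12 (qlift_linear lderiv12_comm).
HB.instance Definition _ := GRing.isLinear.Build F qpoly qpoly *:%R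
  qlswap (qlift_linear lswap_comm).

(* Substitution [lambda_1 = lambda], [lambda_2 = - lambda - d]. *)
Definition leval : {linear vpoly2 V -> vpoly V} :=
  fslin (fun p => iter_lin lmul p.1 \o (iter_lin mlamd p.2 \o mono 0%N)).

Lemma leval_mono i j (v : V) :
  leval (mono (i, j) v) = iter i lmul (iter j mlamd (mono 0%N v)).
Proof. by rewrite /leval /= fslin_mono. Qed.

Fact coefd_lmul f : coefd _ d (lmul f) = lmul (coefd _ d f).
Proof.
have [A ->] := fs_sum_mono f.
rewrite (linear_sum lmul) !(linear_sum (coefd _ d)) (linear_sum lmul).
apply: eq_bigr => i _.
by rewrite mmap_mono (coefd_mono d i) mmap_mono (coefd_mono d i.+1) !scale1r.
Qed.

Fact lmul_mlamd f : lmul (mlamd f) = mlamd (lmul f).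
Proof. by rewrite /mlamd linearB linearN coefd_lmul. Qed.

Fact leval_dlam12 f : leval (dlam12 f) = 0.
Proof.
have [A ->] := fs_sum_mono f; rewrite !linear_sum big1 // => -[i j] _.
move: (f (i, j)) => v; rewrite dlam12_mono (linearD leval) (linearD leval).
rewrite !leval_mono /= -!iterS.
have C n g : coefd _ d (iter n lmul g) = iter n lmul (coefd _ d g).
  by elim: n => //= n <-; rewrite coefd_lmul.
have D n g : coefd _ d (iter n mlamd g) = iter n mlamd (coefd _ d g).
  elim: n => //= n <-; rewrite /mlamd (linearB (coefd _ d)).
  by rewrite (linearN (coefd _ d)) coefd_lmul.
rewrite -coefd_mono -D -C; set g := iter j mlamd _.
rewrite -[iter i.+1 _ _]/(lmul (iter i lmul g)).
rewrite -[iter j.+1 _ _]/(mlamd g).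
have -> : iter i lmul (mlamd g) = mlamd (iter i lmul g).
  by elim: i => //= i ->; rewrite lmul_mlamd.
by rewrite /mlamd addrA -opprD [lmul _ + _]addrC subrr.
Qed.

(* The identification of [V[lambda_1, lambda_2] / <d + lambda_1 + lambda_2>]
   with [V[lambda]], written [X_{lambda, - lambda - d}] on values of [X]. *)
Definition qeval (q : qpoly) : vpoly V := leval (qrep q).

Lemma qeval_pi f : qeval (qpi f) = leval f.
Proof.
have /qpiP[h e] := qrepK (qpi f).
by apply/eqP; rewrite /qeval -subr_eq0 -linearB e leval_dlam12.
Qed.

Fact qeval_is_linear : linear qeval.
Proof.
move=> a q r; rewrite -[q]qrepK -[r]qrepK -linearP !qeval_pi.
by rewrite linearP.
Qed.
HB.instance Definition _ :=
  GRing.isLinear.Build F qpoly (vpoly V) *:%R qeval qeval_is_linear.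

End Poly.

(* [F[z_12^{+1}, z_12^{-1}]] with [z_12 = z_1 - z_2], the exponent [n : int]
   being that of [z_12]; thus [d/dz_2 = - d/dz_1], and exchanging [z_1] and
   [z_2] changes the sign of [z_12]. *)
Notation laurent F := {fs int, F^o}.

Section Laurent.
Variable F : fieldType.

Definition zderiv1 : {linear laurent F -> laurent F} :=
  mmap F^o (fun n : int => n%:~R) (fun n => n - 1).
Definition zderiv2 : {linear laurent F -> laurent F} := \- zderiv1.
Definition zmul12 : {linear laurent F -> laurent F} :=
  mmap F^o (fun=> 1) (fun n : int => n + 1).
Definition zmul21 : {linear laurent F -> laurent F} := \- zmul12.
Definition zswap : {linear laurent F -> laurent F} :=
  mmap F^o (fun n : int => (-1) ^ n) id.

(* [1 / (z_2 - z_1)]. *)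
Definition zinv21 : laurent F := - mono (-1 : int) (1 : F^o).

Lemma zmul21_zinv21 : zmul21 zinv21 = mono (0 : int) (1 : F^o).
Proof.
rewrite -[LHS]/(- zmul12 zinv21) /zinv21 linearN opprK.
by rewrite /zmul12 mmap_mono scale1r.
Qed.

End Laurent.

Section ChiralOne.
Variables (F : fieldType) (V : lmodType F) (S : superspace V).
Variable d : {linear V -> V}.

Record W1ch_axioms (X : V -> V -> laurent F -> qpoly d) : Prop := {
  W1ch_linear1 : forall v f, linear (fun u => X u v f);
  W1ch_linear2 : forall u f, linear (fun v => X u v f);
  W1ch_linear3 : forall u v, linear (X u v);
  W1ch_sesq1 : forall u v f,
    X (d u) v f + qlmul1 (X u v f) = X u v (zderiv1 F f);
  W1ch_sesq2 : forall u v f,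
    X u (d v) f + qlmul2 (X u v f) = X u v (zderiv2 F f);
  W1ch_zmul12 : forall u v f, X u v (zmul12 F f) = qlderiv21 (X u v f);
  W1ch_zmul21 : forall u v f, X u v (zmul21 F f) = qlderiv12 (X u v f);
  W1ch_sym : forall (a b : bool) u v f, has_parity S a u -> has_parity S b v ->
    X u v f = (-1) ^+ (a * b) *: qlswap (X v u (zswap F f))
}.

Definition W1ch_pred : {pred V -> V -> laurent F -> qpoly d} :=
  fun X => `[< W1ch_axioms X >].

Fact W1ch_closed : submod_closed W1ch_pred.
Proof.
split.
  apply/asboolP.
  have E u v f : (0 : V -> V -> laurent F -> qpoly d) u v f = 0 by [].
  by split=> *; do ?move=> ?; rewrite /= ?E ?linear0 ?addr0 ?scaler0.
move=> k X Y /asboolP[] X1 X2 X3 X4 X5 X6 X7 X8.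
move=> /asboolP[] Y1 Y2 Y3 Y4 Y5 Y6 Y7 Y8; apply/asboolP.
have E u v f : (k *: X + Y) u v f = k *: X u v f + Y u v f by [].
split.
- move=> v f a u u'; rewrite /= !E (X1 v f) (Y1 v f).
  by rewrite !scalerDr !scalerA [a * k]mulrC addrACA.
- move=> v f a u u'; rewrite /= !E (X2 v f) (Y2 v f).
  by rewrite !scalerDr !scalerA [a * k]mulrC addrACA.
- move=> v f a u u'; rewrite /= !E (X3 v f) (Y3 v f).
  by rewrite !scalerDr !scalerA [a * k]mulrC addrACA.
- by move=> u v f; rewrite !E linearP -X4 -Y4 scalerDr addrACA.
- by move=> u v f; rewrite !E linearP -X5 -Y5 scalerDr addrACA.
- by move=> u v f; rewrite !E linearP X6 Y6.
- by move=> u v f; rewrite !E linearP X7 Y7.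
- move=> a b u v f ua vb; rewrite !E linearP (X8 a b) // (Y8 a b) //.
  by rewrite scalerDr !scalerA [k * _]mulrC.
Qed.

HB.instance Definition _ := GRing.isSubmodClosed.Build F
  (V -> V -> laurent F -> qpoly d) W1ch_pred W1ch_closed.

(* [W_1^ch] of the superspace [(V, S)] with the endomorphism [d]. *)
Record W1ch := MkW1ch {
  W1ch_fun :> V -> V -> laurent F -> qpoly d;
  _ : W1ch_fun \in W1ch_pred
}.

HB.instance Definition _ := [isSub for W1ch_fun].
HB.instance Definition _ := [Choice of W1ch by <:].
HB.instance Definition _ := [SubChoice_isSubLmodule of W1ch by <:].

End ChiralOne.

Section IntegralBracket.
Variables (F : fieldType) (V : lmodType F) (S : superspace V).
Variable d : {linear V -> V}.

(* For an integral bracket [B], [normprod B u v] is [:uv:] and [lbracket B u v]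
   is [[u_lambda v]]. *)
Definition normprod (B : V -> V -> vpoly V) (u v : V) : V := lconst (B u v).
Definition lbracket (B : V -> V -> vpoly V) (u v : V) : vpoly V :=
  lderiv V (B u v).

Record intbracket_axioms (B : V -> V -> vpoly V) : Prop := {
  intbracket_linear1 : forall v, linear (fun u => B u v);
  intbracket_linear2 : forall u, linear (B u);
  intbracket_sesq1 : forall u v, lbracket B (d u) v = - lmul V (lbracket B u v);
  intbracket_sesq2 : forall u v,
    lbracket B u (d v) = coefd _ d (lbracket B u v) + lmul V (lbracket B u v);
  intbracket_deriv : forall u v,
    d (normprod B u v) = normprod B (d u) v + normprod B u (d v);
  intbracket_skew : forall (a b : bool) u v,
    has_parity S a u -> has_parity S b v ->
    B v u = (-1) ^+ (a * b) *: lsubst d (B u v)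
}.

Definition intbracket_pred : {pred V -> V -> vpoly V} :=
  fun B => `[< intbracket_axioms B >].

Fact intbracket_closed : submod_closed intbracket_pred.
Proof.
split.
  apply/asboolP.
  have E u v : (0 : V -> V -> vpoly V) u v = 0 by [].
  split=> *; do ?move=> ?; rewrite /lbracket /normprod /lconst /= ?E;
    by rewrite ?fs0_E ?linear0 ?addr0 ?oppr0 ?scaler0.
move=> k X Y /asboolP[] X1 X2 X3 X4 X5 X6.
move=> /asboolP[] Y1 Y2 Y3 Y4 Y5 Y6; apply/asboolP.
have E u v : (k *: X + Y) u v = k *: X u v + Y u v by [].
have EL u v : lbracket (k *: X + Y) u v = k *: lbracket X u v + lbracket Y u v.
  by rewrite /lbracket E linearP.
have EN u v : normprod (k *: X + Y) u v = k *: normprod X u v + normprod Y u v.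
  by [].
split.
- move=> v a u u'; rewrite /= !E (X1 v) (Y1 v).
  by rewrite !scalerDr !scalerA [a * k]mulrC addrACA.
- move=> v a u u'; rewrite /= !E (X2 v) (Y2 v).
  by rewrite !scalerDr !scalerA [a * k]mulrC addrACA.
- by move=> u v; rewrite !EL X3 Y3 (linearP (lmul V)) opprD scalerN.
- move=> u v; rewrite !EL X4 Y4 (linearP (lmul V)) (linearP (coefd _ d)).
  by rewrite scalerDr addrACA.
- by move=> u v; rewrite !EN linearP X5 Y5 scalerDr addrACA.
- move=> a b u v ua vb; rewrite !E linearP (X6 a b) // (Y6 a b) //.
  by rewrite scalerDr !scalerA [k * _]mulrC.
Qed.

HB.instance Definition _ := GRing.isSubmodClosed.Build F
  (V -> V -> vpoly V) intbracket_pred intbracket_closed.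

(* Integral lambda-brackets satisfying sesquilinearity and skewsymmetry. *)
Record intbracket := MkIntbracket {
  intbracket_fun :> V -> V -> vpoly V;
  _ : intbracket_fun \in intbracket_pred
}.

HB.instance Definition _ := [isSub for intbracket_fun].
HB.instance Definition _ := [Choice of intbracket by <:].
HB.instance Definition _ := [SubChoice_isSubLmodule of intbracket by <:].

End IntegralBracket.

(* Main.v *)
(* Through qeval, an element X of W_1^ch becomes a family of maps
   V (x) V -> V[lambda], one for each power z_12^m.  The relation
   X(z_12 f) = - d/dlambda X(f) obtains every power m >= 0 from z_12^-1.  In
   characteristic 0 the first sesquilinearity relation
   X(du, v; z_12^m) + lambda X(u, v; z_12^m) = m X(u, v; z_12^(m-1)) obtains
   every power below -1 from z_12^-1 as well.  So X is determined by its value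
   at 1/z_12, and the axioms at the other powers follow, by induction, from
   [D, T] = 1 where D = d/dlambda and (T M)(u, v) = M(du, v) + lambda M(u, v).
   The sign (-1)^p(u) turns skewsymmetry for the reversed parity into
   skewsymmetry for p. *)
Require Import Defs.
From HB Require Import structures.
From mathcomp Require Import all_boot all_order all_algebra.
From mathcomp Require Import boolp.

Set Implicit Arguments.
Unset Strict Implicit.
Unset Printing Implicit Defensive.

Import GRing.Theory.
Local Open Scope ring_scope.

(** * Operators on [V[lambda]]: multiplication, derivative, substitution of [- lambda - d] *)

Section PolyOperators.
Variables (F : fieldType) (V : lmodType F) (d : {linear V -> V}).

Lemma lmul_mono n (v : V) : lmul V (mono n v) = mono n.+1 v.
Proof. by rewrite /lmul mmap_mono scale1r. Qed.

Lemma lderiv_mono n (v : V) : lderiv V (mono n v) = mono n.-1 (n%:R *: v).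
Proof. by rewrite /lderiv mmap_mono. Qed.

Lemma lsubst_mono n (v : V) : lsubst d (mono n v) = iter n (mlamd d) (mono 0%N v).
Proof. by rewrite /lsubst /= fslin_mono. Qed.

(** The Weyl relation. Since [u |-> d u] does not involve lambda, it is the source of [[D, T] =
    1]. *)
Lemma lderiv_lmul f : lderiv V (lmul V f) = lmul V (lderiv V f) + f.
Proof.
move: f; apply: (fs_lin_ext (a := lderiv V \o lmul V)
                            (b := (lmul V \o lderiv V) \+ idfun)) => n v.
rewrite /= lmul_mono !lderiv_mono lmul_mono /=.
case: n => [|n]; first by rewrite scale0r linear0 add0r scale1r.
by rewrite -natr1 scalerDl scale1r linearD.
Qed.

Lemma lderiv_coefd f : lderiv V (coefd _ d f) = coefd _ d (lderiv V f).
Proof.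
move: f; apply: (fs_lin_ext (a := lderiv V \o coefd _ d)
                            (b := coefd _ d \o lderiv V)) => n v.
rewrite [LHS]/= [RHS]/= coefd_mono !lderiv_mono.
by rewrite (coefd_mono (I := nat)) linearZ_LR.
Qed.

Lemma mlamd_coefd f : mlamd d (coefd _ d f) = coefd _ d (mlamd d f).
Proof. by rewrite /mlamd -coefd_lmul linearB linearN. Qed.

Lemma lderiv_mlamd f : lderiv V (mlamd d f) = mlamd d (lderiv V f) - f.
Proof.
rewrite /mlamd linearB linearN lderiv_lmul lderiv_coefd opprD.
by rewrite addrAC.
Qed.

Lemma lsubst_lmul f : lsubst d (lmul V f) = mlamd d (lsubst d f).
Proof.
move: f; apply: (fs_lin_ext (a := lsubst d \o lmul V)
                            (b := mlamd d \o lsubst d)) => n v.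
by rewrite [LHS]/= [RHS]/= lmul_mono !lsubst_mono.
Qed.

Lemma lsubst_coefd f : lsubst d (coefd _ d f) = coefd _ d (lsubst d f).
Proof.
move: f; apply: (fs_lin_ext (a := lsubst d \o coefd _ d)
                            (b := coefd _ d \o lsubst d)) => n v.
rewrite [LHS]/= [RHS]/= coefd_mono !lsubst_mono.
elim: n => [|n IHn]; first by rewrite /= (coefd_mono (I := nat)).
by rewrite !iterS IHn mlamd_coefd.
Qed.

(** The substitution is an involution on the variable: [- lambda - d] becomes [lambda + d - d].
    Swapping the arguments therefore exchanges the two sesquilinearity relations. *)
Lemma lsubst_mlamd f : lsubst d (mlamd d f) = lmul V (lsubst d f).
Proof.
rewrite {1}/mlamd linearB linearN lsubst_lmul lsubst_coefd /mlamd.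
by rewrite opprD !opprK addrK.
Qed.

(** Chain rule: [- lambda - d] has derivative [-1], and [d] commutes with both lambda and the
    derivative. *)
Lemma lderiv_lsubst f : lderiv V (lsubst d f) = - lsubst d (lderiv V f).
Proof.
move: f; apply: (fs_lin_ext (a := lderiv V \o lsubst d)
                            (b := \- (lsubst d \o lderiv V))) => n v.
rewrite -[LHS]/(lderiv V (lsubst d (mono n v))).
rewrite -[RHS]/(- lsubst d (lderiv V (mono n v))) lderiv_mono !lsubst_mono.
elim: n => [|n IHn]; first by rewrite /= lderiv_mono scale0r !linear0.
rewrite iterS lderiv_mlamd IHn.
case: n {IHn} => [|n] /=; first by rewrite scale0r !linear0 sub0r scale1r.
rewrite linearN -opprD; congr (- _).
set g := iter n _ _.
have it (a : F) k : iter k (mlamd d) (mono 0%N (a *: v)) =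
  a *: iter k (mlamd d) (mono 0%N v).
  by elim: k => [|k /= ->]; rewrite /= linearZ_LR.
rewrite /g !it -[in RHS]natr1 scalerDl scale1r.
exact/esym/(linearD (mlamd d)).
Qed.

Lemma fs_sumE (I : choiceType) J (r : seq J) (G : J -> {fs I, V}) i :
  (\sum_(j <- r) G j) i = \sum_(j <- r) G j i.
Proof. by elim/big_rec2: _ => // j y1 y2 _ <-; rewrite fsD_E. Qed.

Lemma lderivE f n : lderiv V f n = n.+1%:R *: f n.+1.
Proof.
have [A ->] := fs_sum_mono f.
rewrite linear_sum !fs_sumE scaler_sumr; apply: eq_bigr => i _.
(* At exponent 0 the truncated predecessor is again 0, which is harmless because the scalar vanishes
   there. *)
rewrite lderiv_mono !monoE; case: i => [|i] /=.
  by rewrite scale0r if_same scaler0.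
by rewrite eqSS; case: eqP => [->|]; rewrite ?scaler0.
Qed.

Lemma coefdE (f : vpoly V) n : coefd _ d f n = d (f n).
Proof.
have [A ->] := fs_sum_mono f.
rewrite (linear_sum (coefd _ d)) !fs_sumE linear_sum; apply: eq_bigr => i _.
by rewrite (coefd_mono (I := nat)) !monoE; case: eqP; rewrite ?linear0.
Qed.

(** Each coefficient of positive degree is recovered from the derivative by dividing by its degree,
    which is invertible in characteristic 0; the constant term supplies the rest. *)
Lemma lderiv_lconst_inj (charF : [pchar F] =i pred0) (f g : vpoly V) :
  lderiv V f = lderiv V g -> lconst f = lconst g -> f = g.
Proof.
move=> fg fg0; apply: fsP => -[//|n].
have := congr1 (fun h : vpoly V => h n) fg; rewrite /= !lderivE.
by apply: scalerI; rewrite ((pcharf0P F).1 charF).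
Qed.

End PolyOperators.

(** * Isomorphism of the two-variable quotient with [V[lambda]], and transport of operators *)

Section Quotient.
Variables (F : fieldType) (V : lmodType F) (d : {linear V -> V}).

(* Defs.qpoly is qualified because mathcomp's qpoly shadows it. *)
Definition qemb : {linear vpoly V -> Defs.qpoly d} :=
  fslin (fun n => qpi d \o mono (n, 0%N)).

Lemma qemb_mono n (v : V) : qemb (mono n v) = qpi d (mono (n, 0%N) v).
Proof. by rewrite /qemb /= fslin_mono. Qed.

Lemma qembK f : qeval (qemb f) = f.
Proof.
move: f; apply: (fs_lin_ext (a := @qeval _ _ d \o qemb) (b := idfun)) => n v.
rewrite [LHS]/= qemb_mono qeval_pi leval_mono /=.
by elim: n => //= n ->; rewrite lmul_mono.
Qed.

Lemma qlmul1_qpi f : qlmul1 (qpi d f) = qpi d (lmul1 V f).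
Proof. exact/qlift_pi/lmul1_comm. Qed.

Lemma qlmul2_qpi f : qlmul2 (qpi d f) = qpi d (lmul2 V f).
Proof. exact/qlift_pi/lmul2_comm. Qed.

Lemma qemb_lmul f : qemb (lmul V f) = qlmul1 (qemb f).
Proof.
move: f; apply: (fs_lin_ext (a := qemb \o lmul V) (b := @qlmul1 _ _ d \o qemb)).
move=> n v; rewrite [LHS]/= [RHS]/= lmul_mono !qemb_mono qlmul1_qpi.
by rewrite /lmul1 mmap_mono scale1r.
Qed.

Lemma qemb_mlamd f : qemb (mlamd d f) = qlmul2 (qemb f).
Proof.
move: f; apply: (fs_lin_ext (a := qemb \o mlamd d) (b := @qlmul2 _ _ d \o qemb)).
move=> n v; rewrite [LHS]/= [RHS]/= /mlamd lmul_mono (coefd_mono (I := nat)).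
rewrite linearB linearN !qemb_mono qlmul2_qpi /lmul2 mmap_mono scale1r.
rewrite -!(linearN (qpi d)) -(linearD (qpi d)); apply/qpiP.
(* Modulo the image, [lambda_2] equals [- lambda_1 - d]; the two sides differ by
   [d + lambda_1 + lambda_2] applied to [- lambda_1^n v]. *)
exists (- mono (n, 0%N) v); rewrite (linearN (dlam12 d)) dlam12_mono /=.
by rewrite -!opprD addrCA addrA.
Qed.

Lemma qemb_iter_mlamd n f :
  qemb (iter n (mlamd d) f) = iter n (@qlmul2 _ _ d) (qemb f).
Proof. by elim: n => //= n <-; rewrite qemb_mlamd. Qed.

Lemma iter_qlmul2 i n (v : V) :
  iter n (@qlmul2 _ _ d) (qpi d (mono (i, 0%N) v)) = qpi d (mono (i, n) v).
Proof.
by elim: n => //= n ->; rewrite qlmul2_qpi /lmul2 mmap_mono scale1r.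
Qed.

(** Every class has a representative free of [lambda_2], because multiplication by [lambda_2] is
    [mlamd] on such representatives. With [qembK] this makes [qeval] an isomorphism, so the axioms
    can be checked in [V[lambda]]. *)
Lemma qevalK q : qemb (qeval q) = q.
Proof.
rewrite -[q in RHS]qrepK /qeval; move: (qrep q).
apply: (fs_lin_ext (a := qemb \o leval d) (b := qpi d)) => -[i j] v.
rewrite -[LHS]/(qemb (leval d (mono (i, j) v))) leval_mono.
rewrite -[RHS]/(qpi d (mono (i, j) v)).
have -> : qpi d (mono (i, j) v) = iter i (@qlmul1 _ _ d) (qpi d (mono (0%N, j) v)).
  by elim: i => //= i <-; rewrite qlmul1_qpi /lmul1 mmap_mono scale1r.
elim: i => [|i IHi]; first by rewrite qemb_iter_mlamd qemb_mono iter_qlmul2.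
by rewrite !iterS qemb_lmul IHi.
Qed.

(** The chosen representative does not contain [lambda_2], so only the [lambda_1] term of [lderiv21]
    survives. *)
Lemma qemb_lderiv f : qemb (- lderiv V f) = qlderiv21 (qemb f).
Proof.
move: f; apply: (fs_lin_ext (a := qemb \o \- lderiv V)
                            (b := @qlderiv21 _ _ d \o qemb)) => n v.
rewrite [LHS]/= [RHS]/= linearN lderiv_mono !qemb_mono.
rewrite /qlderiv21 (qlift_pi (@lderiv21_comm _ _ d)) -linearN; congr (qpi _ _).
rewrite -[RHS]/(lderiv2 V (mono (n, 0%N) v) - lderiv1 V (mono (n, 0%N) v)).
by rewrite /lderiv2 /lderiv1 !mmap_mono /= scale0r linear0 sub0r.
Qed.

(** Swapping turns [lambda_1^n] into [lambda_2^n], which is the n-th power of [- lambda - d] in the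
    quotient. *)
Lemma qemb_lsubst f : qemb (lsubst d f) = qlswap (qemb f).
Proof.
move: f; apply: (fs_lin_ext (a := qemb \o lsubst d)
                            (b := @qlswap _ _ d \o qemb)) => n v.
rewrite [LHS]/= [RHS]/= lsubst_mono qemb_iter_mlamd !qemb_mono iter_qlmul2.
rewrite /qlswap (qlift_pi (@lswap_comm _ _ d)).
by rewrite /lswap mmap_mono scale1r.
Qed.

Lemma qlderiv12E (q : Defs.qpoly d) : qlderiv12 q = - qlderiv21 q.
Proof.
rewrite -[q]qrepK /qlderiv12 /qlderiv21.
rewrite (qlift_pi (@lderiv12_comm _ _ d)) (qlift_pi (@lderiv21_comm _ _ d)).
rewrite -linearN; congr (qpi _ _); move: (qrep q) => f.
by rewrite -[RHS]/(- (lderiv2 V f - lderiv1 V f)) opprB.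
Qed.

Lemma qeval_qlmul1 q : qeval (qlmul1 q) = lmul V (@qeval _ _ d q).
Proof. by rewrite -{1}[q]qevalK -qemb_lmul qembK. Qed.

Lemma qeval_qlmul2 q : qeval (qlmul2 q) = mlamd d (@qeval _ _ d q).
Proof. by rewrite -{1}[q]qevalK -qemb_mlamd qembK. Qed.

Lemma qeval_qlderiv21 q : qeval (qlderiv21 q) = - lderiv V (@qeval _ _ d q).
Proof. by rewrite -{1}[q]qevalK -qemb_lderiv qembK. Qed.

Lemma qeval_qlswap q : qeval (qlswap q) = lsubst d (@qeval _ _ d q).
Proof. by rewrite -{1}[q]qevalK -qemb_lsubst qembK. Qed.

End Quotient.

(** * The sign operator of the grading *)

Section Parity.
Variables (F : fieldType) (V : lmodType F) (S : superspace V).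
Variables (d : {linear V -> V}) (d_even : even_endo S d).

(** Extends the sign [(-1)^p(u)] linearly to inhomogeneous vectors, so that the bracket is defined
    on all of [V]. *)
Definition parity_inv : {linear V -> V} := sproj S false \- sproj S true.

Lemma sproj_homog b v : has_parity S b (sproj S b v).
Proof. by rewrite /has_parity sproj_proj eqxx. Qed.

Lemma parity_inv_homog b v : has_parity S b v -> parity_inv v = (-1) ^+ b *: v.
Proof.
move=> vb; rewrite -[LHS]/(sproj S false v - sproj S true v) -vb !sproj_proj.
by case: b {vb}; rewrite /= ?scaleN1r ?scale1r ?subr0 ?sub0r ?vb.
Qed.

Lemma parity_invK v : parity_inv (parity_inv v) = v.
Proof.
rewrite -[parity_inv v]/(sproj S false v - sproj S true v) linearB.
rewrite (parity_inv_homog (sproj_homog false v)).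
rewrite (parity_inv_homog (sproj_homog true v)).
by rewrite expr0 expr1 scale1r scaleN1r opprK sproj_sum.
Qed.

Lemma parity_inv_even v : parity_inv (d v) = d (parity_inv v).
Proof.
have dp b : has_parity S b (d (sproj S b v)).
  exact/d_even/sproj_homog.
rewrite -[in LHS](sproj_sum S v) !linearD.
rewrite (parity_inv_homog (dp false)) (parity_inv_homog (dp true)).
by rewrite expr0 expr1 scale1r scaleN1r linearN.
Qed.

End Parity.

(** * Bundling of linear maps *)

Section PackLinear.
Variables (F : fieldType) (U W : lmodType F).

Definition linear_pack (f : U -> W) (lf : linear f) : {linear U -> W} :=
  HB.pack f (GRing.isLinear.Build F U W *:%R f lf).

Definition scale_by (w : W) (c : F^o) : W := (c : F) *: w.

Fact scale_by_is_linear w : linear (scale_by w).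
Proof. by move=> a b c; rewrite /scale_by scalerDl scalerA. Qed.

HB.instance Definition _ w :=
  GRing.isLinear.Build F F^o W *:%R (scale_by w) (scale_by_is_linear w).

End PackLinear.

(** * Reconstruction of all Laurent modes from the value at [z_12^-1] *)

Section Modes.
Variables (F : fieldType) (charF : [pchar F] =i pred0).
(* A is the prescribed value at z_12^-1, and [mode m] the value it forces at
   z_12^m. *)
Variables (V : lmodType F) (d : {linear V -> V}) (A : V -> V -> vpoly V).

(** Solves the first sesquilinearity relation at exponent [-(m+1)] for the value at [-(m+2)]. Thus
    [negmode n] sits at [-(n+1)], n steps below [-1], whereas exponent [n] lies n+1 steps above,
    hence [n.+1] derivatives in [mode]. *)
Fixpoint negmode n : V -> V -> vpoly V :=
  if n is m.+1 then
    fun u v => - m.+1%:R^-1 *: (negmode m (d u) v + lmul V (negmode m u v))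
  else A.

Definition mode (m : int) (u v : V) : vpoly V :=
  match m with
  | Posz n => iter n.+1 (\- lderiv V) (A u v)
  | Negz n => negmode n u v
  end.

Lemma mode_pos n u v : mode n.+1 u v = - lderiv V (mode n u v).
Proof. by []. Qed.

Lemma mode0 u v : mode 0 u v = - lderiv V (A u v).
Proof. by []. Qed.

Lemma mode_neg n u v : mode (Negz n.+1) u v =
  - n.+1%:R^-1 *: (mode (Negz n) (d u) v + lmul V (mode (Negz n) u v)).
Proof. by []. Qed.

Hypothesis A_linear1 : forall v, linear (A^~ v).
Hypothesis A_linear2 : forall u, linear (A u).
Hypothesis A_sesq : forall u v,
  lderiv V (A (d u) v) = - lmul V (lderiv V (A u v)).
Hypothesis A_coefd : forall u v, coefd _ d (A u v) = A (d u) v + A u (d v).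

Lemma mode_linear1 m v : linear (mode m ^~ v).
Proof.
case: m => n a u u'.
  elim: n => [|n IHn]; first by rewrite !mode0 A_linear1 linearP opprD scalerN.
  by rewrite !mode_pos IHn linearP opprD scalerN.
elim: n u u' => [|n IHn] u u'; first exact: A_linear1.
rewrite !mode_neg linearP !IHn (linearP (lmul V)) addrACA -(scalerDr a).
rewrite (scalerDr (- _)).
by rewrite !scalerA mulrC.
Qed.

Lemma mode_linear2 m u : linear (mode m u).
Proof.
case: m => n a v v'.
  elim: n => [|n IHn]; first by rewrite !mode0 A_linear2 linearP opprD scalerN.
  by rewrite !mode_pos IHn linearP opprD scalerN.
elim: n u => [|n IHn] u; first exact: A_linear2.
rewrite !mode_neg !IHn (linearP (lmul V)) addrACA -(scalerDr a).
rewrite (scalerDr (- _)).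
by rewrite !scalerA mulrC.
Qed.

(** At exponent 0 this is [A_sesq]. Each further derivative adds one to the factor by [[D, T] = 1].
    For negative exponents it is the recursion defining [negmode]. *)
Lemma mode_sesq1 m u v :
  mode m (d u) v + lmul V (mode m u v) = m%:~R *: mode (m - 1) u v.
Proof.
case: m => n.
  elim: n => [|n IHn].
    by rewrite !mode0 A_sesq (linearN (lmul V)) opprK subrr scale0r.
  have -> : n.+1%:Z - 1 = n by rewrite -addn1 PoszD addrK.
  rewrite !mode_pos (linearN (lmul V)).
  (* Replacing [lambda D] by [D lambda - 1] pulls the derivative out of [T], so that the induction
     hypothesis applies. *)
  rewrite -[lmul V (lderiv V _)](addrK (mode n u v)) -lderiv_lmul opprB.
  rewrite addrCA -opprD -(linearD (lderiv V)) IHn.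
  case: n {IHn} => [|n].
    by rewrite scale0r linear0 subr0 scale1r.
  have -> : n.+1%:Z - 1 = n by rewrite -addn1 PoszD addrK.
  rewrite (linearZ_LR (lderiv V)) -scalerN -mode_pos.
  by rewrite -!pmulrn -[in RHS]natr1 addrC scalerDl scale1r.
have -> : Negz n - 1 = Negz n.+1 by rewrite !NegzE -opprD -PoszD addn1.
rewrite mode_neg scalerA NegzE mulrNz mulrNN -pmulrn mulfV ?scale1r //.
by rewrite ((pcharf0P F).1 charF).
Qed.

Lemma mode_lderiv m u v : mode (m + 1) u v = - lderiv V (mode m u v).
Proof.
case: m => n; first by rewrite -PoszD addn1.
elim: n u => [|n IHn] u; first by [].
have -> : Negz n.+1 + 1 = Negz n.
  by rewrite !NegzE -[n.+2]addn1 PoszD opprD addrNK.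
rewrite [in RHS]mode_neg (linearZ_LR (lderiv V)) (linearD (lderiv V)).
rewrite lderiv_lmul -scalerN scaleNr -scalerN opprK addrA.
have IH w : lderiv V (mode (Negz n) w v) = - mode (Negz n + 1) w v.
  by rewrite IHn opprK.
(* The relation at exponent [-n] contributes n copies of the mode at [Negz n] and the commutator one
   more; the total n+1 cancels the inverse. *)
rewrite !IH (linearN (lmul V)) -opprD mode_sesq1 addrK.
rewrite -scaleNr -[X in _ + X]scale1r -scalerDl scalerA.
rewrite NegzE -[in X in X%:~R]addn1 PoszD opprD addrNK mulrNz opprK natr1.
by rewrite mulVf ?scale1r // ((pcharf0P F).1 charF).
Qed.

(** Holds for [A] by hypothesis and propagates, since [d] on coefficients commutes with the
    derivative and with lambda. It turns the first sesquilinearity relation into the second. *)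
Lemma mode_coefd m u v :
  coefd _ d (mode m u v) = mode m (d u) v + mode m u (d v).
Proof.
case: m => n.
  elim: n => [|n IHn].
    by rewrite !mode0 linearN -lderiv_coefd A_coefd linearD opprD.
  by rewrite !mode_pos linearN -lderiv_coefd IHn linearD opprD.
elim: n u => [|n IHn] u; first exact: A_coefd.
rewrite !mode_neg -scalerDr (linearZ_LR (coefd _ d)) (linearD (coefd _ d)).
by rewrite coefd_lmul !IHn (linearD (lmul V)) addrACA.
Qed.

Lemma mode_sesq2 m u v :
  mode m u (d v) + mlamd d (mode m u v) = - (m%:~R *: mode (m - 1) u v).
Proof.
rewrite -mode_sesq1 /mlamd mode_coefd !opprD [LHS]addrC [X in X + _]addrA subrK.
exact: addrC.
Qed.

(** [P] will fix the parities of both arguments; closure under [d] in the first one is needed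
    because the downward induction passes through [d u]. At exponent [-1] the factor [(-1)^m]
    explains the [- e] in the hypothesis. *)
Lemma mode_skew (P : V -> V -> Prop) (e : F) :
  (forall u v, P u v -> P (d u) v) ->
  (forall u v, P u v -> A u v = - e *: lsubst d (A v u)) ->
  forall m u v, P u v ->
  mode m u v = (e * (-1) ^ m) *: lsubst d (mode m v u).
Proof.
move=> P_d A_skew.
have signS m : (-1) ^ (m + 1) = - (-1) ^ m :> F.
  by rewrite expfzDr ?oppr_eq0 ?oner_eq0 // expr1z mulrN1.
have base u v : P u v ->
    mode (-1) u v = (e * (-1) ^ (-1)) *: lsubst d (mode (-1) v u).
  by move=> /A_skew; rewrite -invr_expz expr1z invrN1 mulrN1.
have up m u v : mode m u v = (e * (-1) ^ m) *: lsubst d (mode m v u) ->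
    mode (m + 1) u v = (e * (-1) ^ (m + 1)) *: lsubst d (mode (m + 1) v u).
  rewrite !mode_lderiv => ->; rewrite (linearZ_LR (lderiv V)) lderiv_lsubst.
  by rewrite (linearN (lsubst d)) signS mulrN scalerN scaleNr opprK scalerN opprK.
case=> n u v Puv.
  elim: n => [|n IHn]; first exact/(up (-1))/base.
  by have := up _ _ _ IHn; rewrite -PoszD addn1.
elim: n u v Puv => [|n IHn] u v Puv; first exact: base.
have -> : Negz n.+1 = Negz n - 1 by rewrite !NegzE -opprD -PoszD addn1.
have nz : (Negz n)%:~R != 0 :> F.
  by rewrite NegzE mulrNz oppr_eq0 ((pcharf0P F).1 charF).
(* After multiplication by the nonzero exponent, the left side is the first relation for [(u, v)];
   carried through the substitution, it becomes the second relation for [(v, u)]. *)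
apply: (scalerI nz); rewrite -mode_sesq1 (IHn (d u) v (P_d _ _ Puv)) (IHn u v Puv).
rewrite (linearZ_LR (lmul V)) -lsubst_mlamd -scalerDr -(linearD (lsubst d)).
have -> : (-1) ^ Negz n = - (-1) ^ (Negz n - 1) :> F by rewrite -signS subrK.
rewrite mode_sesq2 mulrN scaleNr.
rewrite (linearN (lsubst d)) scalerN opprK (linearZ_LR (lsubst d)).
by rewrite !scalerA mulrC.
Qed.

Definition modal (u v : V) : {linear laurent F -> vpoly V} :=
  fslin (fun m => scale_by (mode m u v)).

Lemma modal_mono u v m c : modal u v (mono m c) = (c : F) *: mode m u v.
Proof. by rewrite /modal /= fslin_mono. Qed.

Lemma modal_linear1 f v : linear (fun u => modal u v f).
Proof.
move=> a u u'; move: f.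
apply: (fs_lin_ext (a := modal _ v) (b := (a \*: modal u v) \+ modal u' v)) => m c.
rewrite -[RHS]/(a *: modal u v (mono m c) + modal u' v (mono m c)).
by rewrite !modal_mono mode_linear1 scalerDr !scalerA mulrC.
Qed.

Lemma modal_linear2 f u : linear (fun v => modal u v f).
Proof.
move=> a v v'; move: f.
apply: (fs_lin_ext (a := modal u _) (b := (a \*: modal u v) \+ modal u v')) => m c.
rewrite -[RHS]/(a *: modal u v (mono m c) + modal u v' (mono m c)).
by rewrite !modal_mono mode_linear2 scalerDr !scalerA mulrC.
Qed.

Lemma modal_sesq1 u v f :
  modal (d u) v f + lmul V (modal u v f) = modal u v (zderiv1 F f).
Proof.
move: f; apply: (fs_lin_ext (a := modal (d u) v \+ (lmul V \o modal u v))
                            (b := modal u v \o zderiv1 F)) => m c.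
rewrite -[LHS]/(modal (d u) v (mono m c) + lmul V (modal u v (mono m c))).
rewrite -[RHS]/(modal u v (zderiv1 F (mono m c))) /zderiv1 mmap_mono !modal_mono.
rewrite (linearZ_LR (lmul V)) -scalerDr mode_sesq1 scalerA; congr (_ *: _).
exact: mulrC.
Qed.

Lemma modal_sesq2 u v f :
  modal u (d v) f + mlamd d (modal u v f) = modal u v (zderiv2 F f).
Proof.
move: f; apply: (fs_lin_ext (a := modal u (d v) \+ (mlamd d \o modal u v))
                            (b := modal u v \o zderiv2 F)) => m c.
rewrite -[LHS]/(modal u (d v) (mono m c) + mlamd d (modal u v (mono m c))).
rewrite -[RHS]/(modal u v (- zderiv1 F (mono m c))) linearN.
rewrite /zderiv1 mmap_mono !modal_mono.
rewrite (linearZ_LR (mlamd d)) -scalerDr mode_sesq2 scalerN scalerA.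
by congr (- (_ *: _)); exact: mulrC.
Qed.

Lemma modal_zmul12 u v f : modal u v (zmul12 F f) = - lderiv V (modal u v f).
Proof.
move: f; apply: (fs_lin_ext (a := modal u v \o zmul12 F)
                            (b := \- (lderiv V \o modal u v))) => m c.
rewrite -[LHS]/(modal u v (zmul12 F (mono m c))).
rewrite -[RHS]/(- lderiv V (modal u v (mono m c))).
rewrite /zmul12 mmap_mono scale1r !modal_mono mode_lderiv scalerN.
by rewrite (linearZ_LR (lderiv V)).
Qed.

Lemma modal_skew (P : V -> V -> Prop) (e : F) :
  (forall u v, P u v -> P (d u) v) ->
  (forall u v, P u v -> A u v = - e *: lsubst d (A v u)) ->
  forall u v f, P u v ->
  modal u v f = e *: lsubst d (modal v u (zswap F f)).
Proof.
move=> P_d A_skew u v f Puv; move: f.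
apply: (fs_lin_ext (a := modal u v)
                   (b := e \*: (lsubst d \o (modal v u \o zswap F)))) => m c.
rewrite -[RHS]/(e *: lsubst d (modal v u (zswap F (mono m c)))).
rewrite /zswap mmap_mono !modal_mono (mode_skew P_d A_skew) //.
rewrite (linearZ_LR (lsubst d)) !scalerA; congr (_ *: _).
by rewrite [LHS]mulrC -[LHS]mulrA.
Qed.

End Modes.

(** * The two directions of the correspondence *)

Section Bijection.
Variables (F : fieldType) (charF : [pchar F] =i pred0).
Variables (V : lmodType F) (S : superspace V).
Variables (d : {linear V -> V}) (d_even : even_endo S d).

Lemma W1chP (T : superspace V) (X : W1ch T d) : W1ch_axioms T X.
Proof. exact/asboolP/(valP X). Qed.

Lemma intbracketP (B : intbracket S d) : intbracket_axioms S d B.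
Proof. exact/asboolP/(valP B). Qed.

Lemma zinv21_zmul12 : zmul12 F (zinv21 F) = - mono (0 : int) (1 : F^o).
Proof. by rewrite linearN /zmul12 mmap_mono scale1r. Qed.

Lemma zderiv1_const : zderiv1 F (mono (0 : int) (1 : F^o)) = 0.
Proof. by rewrite /zderiv1 mmap_mono scale0r linear0. Qed.

Lemma zswap_zinv21 : zswap F (zinv21 F) = - zinv21 F.
Proof.
rewrite /zinv21 linearN /zswap mmap_mono; congr (- _).
by rewrite -invr_expz expr1z invrN1 scaleN1r linearN.
Qed.

(** * From chiral maps to integral brackets, and injectivity *)

Section Value.
Variable X : W1ch (revpar S) d.

Definition value (u v : V) : {linear laurent F -> vpoly V} :=
  @qeval _ _ d \o linear_pack (W1ch_linear3 (W1chP X) u v).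

Lemma value_linear1 v f : linear (fun u => value u v f).
Proof. by move=> a u u'; rewrite /value /= (W1ch_linear1 (W1chP X)) linearP. Qed.

Lemma value_scale1 a u v f : value (a *: u) v f = a *: value u v f.
Proof. exact: (linearZ_LR (linear_pack (value_linear1 v f))). Qed.

Lemma value_linear2 u f : linear (fun v => value u v f).
Proof. by move=> a v v'; rewrite /value /= (W1ch_linear2 (W1chP X)) linearP. Qed.

Lemma value_sesq1 u v f :
  value (d u) v f + lmul V (value u v f) = value u v (zderiv1 F f).
Proof.
rewrite -[RHS]/(qeval (X u v (zderiv1 F f))) -(W1ch_sesq1 (W1chP X)).
rewrite (linearD (@qeval _ _ d)); congr (_ + _); exact/esym/qeval_qlmul1.
Qed.

Lemma value_sesq2 u v f :
  value u (d v) f + mlamd d (value u v f) = - value u v (zderiv1 F f).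
Proof.
rewrite -(linearN (value u v)) -[RHS]/(qeval (X u v (zderiv2 F f))).
rewrite -(W1ch_sesq2 (W1chP X)) (linearD (@qeval _ _ d)); congr (_ + _).
exact/esym/qeval_qlmul2.
Qed.

(** Sum of the two sesquilinearity relations: [d/dz_1 + d/dz_2] kills functions of [z_12]. *)
Lemma value_coefd u v f :
  coefd _ d (value u v f) = value (d u) v f + value u (d v) f.
Proof.
have /eqP := value_sesq2 u v f; rewrite -value_sesq1 /mlamd opprD addrA.
rewrite subr_eq addrAC (inj_eq (addIr _)) eq_sym [- _ + _]addrC subr_eq addrC.
by move/eqP.
Qed.

Lemma value_zmul12 u v f : value u v (zmul12 F f) = - lderiv V (value u v f).
Proof.
rewrite -[LHS]/(qeval (X u v (zmul12 F f))) (W1ch_zmul12 (W1chP X)).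
exact: qeval_qlderiv21.
Qed.

Lemma value_skew a b u v f : has_parity S a u -> has_parity S b v ->
  value u v f = (-1) ^+ (~~ a * ~~ b) *: lsubst d (value v u (zswap F f)).
Proof.
move=> ua vb; rewrite -[LHS]/(qeval (X u v f)).
rewrite (W1ch_sym (W1chP X) (a := ~~ a) (b := ~~ b)) /has_parity /= ?negbK //.
by rewrite (linearZ_LR (@qeval _ _ d)); congr (_ *: _); exact: qeval_qlswap.
Qed.

Definition bracket_of (u v : V) : vpoly V :=
  value (parity_inv S u) v (zinv21 F).

(** Differentiating in lambda multiplies [1/(z_2 - z_1)] by [z_2 - z_1], leaving the constant 1. Its
    z-derivative is 0, so sesquilinearity of the lambda-bracket has no correction term. *)
Lemma lbracket_bracket_of u v : lbracket bracket_of u v =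
  value (parity_inv S u) v (mono (0 : int) (1 : F^o)).
Proof.
apply: oppr_inj; rewrite -value_zmul12 zinv21_zmul12.
exact: (linearN (value _ _)).
Qed.

Lemma bracket_of_axioms : bracket_of \in intbracket_pred S d.
Proof.
apply/asboolP; split.
- by move=> v a u u'; rewrite /bracket_of linearP; exact: value_linear1.
- by move=> u a v v'; exact: value_linear2.
- move=> u v; rewrite !lbracket_bracket_of parity_inv_even //; apply/eqP.
  by rewrite -addr_eq0 value_sesq1 zderiv1_const (linear0 (value _ _)).
- move=> u v; rewrite !lbracket_bracket_of; apply/eqP.
  set f := mono _ _; rewrite -subr_eq0 [_ + lmul V _]addrC opprD -/(mlamd d _).
  by rewrite value_sesq2 zderiv1_const (linear0 (value _ _)) oppr0.
- move=> u v; rewrite /normprod /lconst -fsD_E -coefdE.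
  by rewrite value_coefd /bracket_of parity_inv_even.
- move=> a b u v ua vb; rewrite /bracket_of.
  rewrite (parity_inv_homog ua) (parity_inv_homog vb).
  rewrite !value_scale1 (value_skew _ vb ua) zswap_zinv21.
  rewrite (linearN (value _ _)) (linearN (lsubst d)) (linearZ_LR (lsubst d)).
  rewrite !scalerN !scalerA -scaleNr; congr (_ *: _).
  (* Sign count: [(1-a)(1-b) = 1 - a - b + ab], and the extra 1 is absorbed by the oddness of
     [1/(z_2 - z_1)] under the swap. *)
  by case: a b {ua vb} => [] [];
    rewrite /= ?expr0 ?expr1 ?mulr1 ?mul1r ?mulrN1 ?opprK.
Qed.

Lemma value_inj0 : (forall u v, value u v (zinv21 F) = 0) -> X = 0.
Proof.
move=> X0.
have up u v m : value u v (mono m 1) = 0 -> value u v (mono (m + 1) 1) = 0.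
  move=> e; have := value_zmul12 u v (mono m 1).
  by rewrite e linear0 oppr0 /zmul12 mmap_mono scale1r.
have base u v : value u v (mono (-1 : int) (1 : F^o)) = 0.
  by apply: oppr_inj; rewrite oppr0 -(linearN (value u v)) X0.
have all0 m u v : value u v (mono m 1) = 0.
  case: m => n.
    elim: n => [|n IHn]; first exact/(up _ _ (-1))/base.
    by have := up _ _ _ IHn; rewrite -PoszD addn1.
  (* The arguments stay general because the relation also involves [d u]; the factor [-(n+1)] is
     then cancelled in characteristic 0. *)
  elim: n u v => [|n IHn] u v; first exact: base.
  have := value_sesq1 u v (mono (Negz n) 1).
  rewrite !IHn linear0 addr0 /zderiv1 mmap_mono.
  have -> : Negz n - 1 = Negz n.+1 by rewrite !NegzE -opprD -PoszD addn1.
  rewrite !linearZ_LR => /esym/eqP; rewrite scaler_eq0 => /orP[|/eqP //].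
  by rewrite NegzE mulrNz oppr_eq0 ((pcharf0P F).1 charF).
apply: val_inj; apply/funext => u; apply/funext => v; apply/funext => f.
rewrite -[LHS](@qevalK _ _ d) -[RHS](linear0 (@qemb _ _ d)); congr (qemb _ _).
rewrite -[LHS]/(value u v f) -[RHS]/((\0 : {linear laurent F -> vpoly V}) f).
apply: fs_lin_ext => m c.
have -> : c = (c : F) *: (1 : F^o) by rewrite -[RHS]/(c * 1) mulr1.
by rewrite (linearZ_LR (mono m)) (linearZ_LR (value u v)) all0 scaler0.
Qed.

End Value.

Definition to_intbracket (X : W1ch (revpar S) d) : intbracket S d :=
  MkIntbracket (bracket_of_axioms X).

Fact to_intbracket_is_linear : linear to_intbracket.
Proof.
move=> a X Y; apply: val_inj; apply/funext => u; apply/funext => v.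
set x := X (parity_inv S u) v (zinv21 F); set y := Y (parity_inv S u) v (zinv21 F).
rewrite -[RHS]/(a *: qeval x + qeval y) -[LHS]/(qeval (a *: x + y)).
exact: (linearP (@qeval _ _ d) a x y).
Qed.

HB.instance Definition _ := GRing.isLinear.Build F
  (W1ch (revpar S) d) (intbracket S d) *:%R to_intbracket to_intbracket_is_linear.

Lemma to_intbracket_homog X b u v : has_parity S b u ->
  to_intbracket X u v = (-1) ^+ b *: qeval (X u v (zinv21 F)).
Proof.
move=> ub; rewrite -[LHS]/(value X (parity_inv S u) v (zinv21 F)).
by rewrite (parity_inv_homog ub) value_scale1.
Qed.

Lemma to_intbracket_inj : injective to_intbracket.
Proof.
apply: raddf_inj => X X0; apply: value_inj0 => u v.
(* The sign operator is its own inverse, so vanishing of the bracket covers every first argument. *)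
rewrite -[u](parity_invK S).
exact: (congr1 (fun B : intbracket S d => B (parity_inv S u) v) X0).
Qed.

(** * From integral brackets back to chiral maps *)

Section Inverse.
Variable B : intbracket S d.

Lemma intbracket_scale1 a u v : B (a *: u) v = a *: B u v.
Proof.
exact: (linearZ_LR (linear_pack (intbracket_linear1 (intbracketP B) v))).
Qed.

(* The minus sign is that of 1/(z_2 - z_1) = - z_12^-1. *)
Definition singular_mode (u v : V) : vpoly V := - B (parity_inv S u) v.

Lemma singular_mode_linear1 v : linear (singular_mode ^~ v).
Proof.
move=> a u u'; rewrite /singular_mode linearP (intbracket_linear1 (intbracketP B)).
by rewrite opprD scalerN.
Qed.

Lemma singular_mode_linear2 u : linear (singular_mode u).
Proof.
move=> a v v'; rewrite /singular_mode (intbracket_linear2 (intbracketP B)).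
by rewrite opprD scalerN.
Qed.

Lemma singular_mode_sesq u v : lderiv V (singular_mode (d u) v) =
  - lmul V (lderiv V (singular_mode u v)).
Proof.
rewrite /singular_mode !(linearN (lderiv V)) parity_inv_even // (linearN (lmul V)).
by congr (- _); exact: (intbracket_sesq1 (intbracketP B)).
Qed.

(** The bracket axioms give this only for the lambda-derivative, where the lambda terms of the two
    sesquilinearity rules cancel, and for the constant term; in characteristic 0 these two
    suffice. *)
Lemma singular_mode_coefd u v : coefd _ d (singular_mode u v) =
  singular_mode (d u) v + singular_mode u (d v).
Proof.
rewrite /singular_mode -opprD (linearN (coefd _ d)) parity_inv_even //.
congr (- _); apply: (lderiv_lconst_inj charF); last first.
  rewrite /lconst coefdE fsD_E.
  exact: (intbracket_deriv (intbracketP B)).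
rewrite lderiv_coefd linearD /=.
have := intbracket_sesq1 (intbracketP B) (parity_inv S u) v.
have := intbracket_sesq2 (intbracketP B) (parity_inv S u) v.
by rewrite /lbracket => -> ->; rewrite addrCA [- _ + _]addrC subrr addr0.
Qed.

Lemma singular_mode_skew a b u v : has_parity S a u -> has_parity S b v ->
  singular_mode u v =
  - (-1) ^+ (~~ a * ~~ b) *: lsubst d (singular_mode v u).
Proof.
move=> ua vb; rewrite /singular_mode (parity_inv_homog ua) (parity_inv_homog vb).
rewrite !intbracket_scale1 (intbracket_skew (intbracketP B) vb ua).
rewrite (linearN (lsubst d)) (linearZ_LR (lsubst d)) scalerN scaleNr opprK.
rewrite !scalerA -scaleNr; congr (_ *: _).
by case: a b {ua vb} => [] [];
  rewrite /= ?expr0 ?expr1 ?mulr1 ?mul1r ?mulrN1 ?opprK.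
Qed.

Definition chiral_of (u v : V) (f : laurent F) : Defs.qpoly d :=
  qemb d (modal d singular_mode u v f).

Lemma chiral_of_axioms : chiral_of \in @W1ch_pred _ _ (revpar S) d.
Proof.
have L1 := singular_mode_linear1; have L2 := singular_mode_linear2.
have A1 := singular_mode_sesq; have A2 := singular_mode_coefd.
have z12 u v f : chiral_of u v (zmul12 F f) = qlderiv21 (chiral_of u v f).
  by rewrite /chiral_of modal_zmul12 // qemb_lderiv.
apply/asboolP; split => //.
- by move=> v f a u u'; rewrite /chiral_of modal_linear1 // linearP.
- by move=> u f a v v'; rewrite /chiral_of modal_linear2 // linearP.
- by move=> u v a f f'; rewrite /chiral_of !linearP.
- by move=> u v f; rewrite /chiral_of -qemb_lmul -linearD modal_sesq1.
- by move=> u v f; rewrite /chiral_of -qemb_mlamd -linearD modal_sesq2.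
- move=> u v f; rewrite qlderiv12E -z12 /chiral_of.
  rewrite -(linearN (qemb d)) -(linearN (modal _ _ _ _)).
  by rewrite -[- _]/(zmul21 F f).
- move=> a b u v f ua vb; rewrite /chiral_of -qemb_lsubst -(linearZ_LR (qemb d)).
  (* Here [a] and [b] are reversed parities, so in [V] the arguments have parities [~~ a] and
     [~~ b]. *)
  congr (qemb _ _); pose P u v := has_parity S (~~ a) u /\ has_parity S (~~ b) v.
  have P_d u' v' : P u' v' -> P (d u') v' by case=> /d_even.
  apply: (modal_skew charF A1 A2 P_d) => // u' v' [u'a v'b].
  by rewrite (singular_mode_skew u'a v'b) !negbK.
Qed.

Definition of_intbracket : W1ch (revpar S) d := MkW1ch chiral_of_axioms.

Lemma of_intbracketK : to_intbracket of_intbracket = B.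
Proof.
apply: val_inj; apply/funext => u; apply/funext => v.
rewrite -[LHS]/(qeval (qemb d (modal d singular_mode (parity_inv S u) v (zinv21 F)))).
rewrite qembK linearN modal_mono scale1r -[mode _ _ _ _ _]/(- B _ v) opprK.
by rewrite parity_invK.
Qed.

End Inverse.

End Bijection.

Theorem proposition6p8 (F : fieldType) (charF : [pchar F] =i pred0)
    (V : lmodType F) (S : superspace V) (d : {linear V -> V})
    (d_even : even_endo S d) :
  exists Phi : {linear W1ch (revpar S) d -> intbracket S d},
    bijective Phi /\
    forall (X : W1ch (revpar S) d) (b : bool) (u v : V), has_parity S b u ->
      Phi X u v = (-1) ^+ b *: qeval (X u v (zinv21 F)).
Proof.
exists (to_intbracket d_even); split; last exact/to_intbracket_homog.
(* An injective map with a right inverse is bijective. *)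
have K : cancel (of_intbracket charF d_even) (to_intbracket d_even).
  exact: of_intbracketK.
exact: (Bijective (inj_can_sym K (@to_intbracket_inj _ charF _ _ _ d_even)) K).
Qed.
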